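(* Let $q>1$ be real and let $p\ge5$ be an odd prime. Then the function $x\mapsto\mathfrak F(x,q)$ has at least one real zero $x_p(q)\in(p-1,p)$.
   Context: For $z\in\mathbb C$ and an integer $i\ge2$, $F(z,i)=i+2\sum_{k=1}^{i-1}(i-k)\cos(2\pi kz/i)$. For $q>1$, $$\mathfrak F(z,q)=(q-1)q\left(\sum_{i=2}^{\infty}\frac{F(z,i)}{i^2}\,q^{-i}-q^{-z}\right),$$ where $q^{-z}=e^{-z\log q}$ with the real logarithm. *)

(* Defs.v *)
From Stdlib Require Import Reals ZArith Znumtheory.
From Coquelicot Require Import Coquelicot.

Open Scope R_scope.

Definition Cexp (z : C) : C := (exp (Re z) * cos (Im z), exp (Re z) * sin (Im z)).

Definition Ccos (z : C) : C := ((Cexp (Ci * z) + Cexp (- (Ci * z))) / 2)%C.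

(* Like [Series], meaningful only when the series converges, see
   [is_series_CSeries]. *)
Definition CSeries (a : nat -> C) : C :=
  (Series (fun n => Re (a n)), Series (fun n => Im (a n))).

Definition FF (z : C) (i : nat) : C :=
  (INR i + 2 * sum_n_m (fun k : nat =>
                 INR (i - k) * Ccos (2 * PI * INR k * z / INR i)) 1 (i - 1))%C.

(* The index [i >= 2] of the series is [n + 2] with [n >= 0]; the series
   converges for every complex [z] when [q > 1]. *)
Definition frakF (z : C) (q : R) : C :=
  ((q - 1) * q *
     (CSeries (fun n : nat => let i := (n + 2)%nat in
                 FF z i / (INR i * INR i) * / (RtoC q ^ i))
      - Cexp (- (z * ln q))))%C.

Lemma is_series_CSeries (a : nat -> C) (l : C) :
  is_series a l -> CSeries a = l.
Proof.
intros H.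
assert (E : forall n, sum_n a n =
  (sum_n (fun k => Re (a k)) n, sum_n (fun k => Im (a k)) n)).
{ induction n as [|n IH].
  - rewrite !sum_O; unfold Re, Im; now destruct (a O).
  - rewrite !sum_Sn, IH; reflexivity. }
assert (H1 : is_series (fun n => Re (a n)) (Re l)).
{ unfold is_series in *.
  apply filterlim_ext with (fun n => fst (sum_n a n)).
  - intros n; now rewrite E.
  - apply filterlim_comp with (1 := H).
    intros P [e He]; exists e; intros y Hy; apply He, Hy. }
assert (H2 : is_series (fun n => Im (a n)) (Im l)).
{ unfold is_series in *.
  apply filterlim_ext with (fun n => snd (sum_n a n)).
  - intros n; now rewrite E.
  - apply filterlim_comp with (1 := H).
    intros P [e He]; exists e; intros y Hy; apply He, Hy. }
unfold CSeries; rewrite (is_series_unique _ _ H1), (is_series_unique _ _ H2).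
now destruct l.
Qed.

(* Main.v *)
Require Import Defs.
From Stdlib Require Import Reals ZArith Znumtheory.
From Coquelicot Require Import Coquelicot.
From Stdlib Require Import Lra Lia.

(** On the real line F(x,i) is the Fejer kernel: with t = 2 pi x / i,
    F(x,i) = |1 + e^(it) + ... + e^(i(i-1)t)|^2 ([fejer_S], [FF_RtoC]).
    Hence F(x,i) / i^2 lies between 0 and 1, and at an integer x it is 1 or 0
    according to whether i divides x. At x = p prime only the index i = p
    survives, so the series equals q^(-p) and p itself is a zero of the
    function. The zero to be found is another one, and it is produced by a
    change of sign on (p-1, p).

    At the even number p - 1 >= 4 the index i = 2 already contributes q^(-2),
    which exceeds q^(-(p-1)); the other terms being nonnegative, the function is
    positive there ([real_frakF_even_pos]).

    Just to the left of p it is negative ([real_frakF_neg_left_of_prime]).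
    Each F(x,i) / i^2 is stationary at p, at its minimum 0 when i <> p and at its
    maximum 1 when i = p, so the series has derivative 0 there, while
    q^(-x) strictly decreases. Quantitatively, at x = p - h the i-th
    exponential sum is O(i h) for i <> p because it vanishes at p; after squaring
    and dividing by i^2 this gives O(h^2) uniformly in i
    ([ratio_le_sq_dist]), whence a series at most q^(-p) + O(h^2), to be
    compared with q^(-p+h) >= q^(-p) (1 + h log q).

    The same uniform Lipschitz bounds on the exponential sums show that the
    series is Lipschitz in x, and the intermediate value theorem applies. *)

Local Open Scope R_scope.

(** * The Fejer kernel as the squared modulus of an exponential sum *)

(** With [sin_sum], the real and imaginary parts of the exponential sum
    S_n = 1 + e^(it) + ... + e^(i(n-1)t). *)
Fixpoint cos_sum (n : nat) (t : R) : R :=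
  match n with O => 0 | S m => cos_sum m t + cos (INR m * t) end.

Fixpoint sin_sum (n : nat) (t : R) : R :=
  match n with O => 0 | S m => sin_sum m t + sin (INR m * t) end.

Definition fejer (n : nat) (t : R) : R := cos_sum n t ^ 2 + sin_sum n t ^ 2.

Lemma cos_INR_S (n : nat) (t : R) :
  cos (INR (S n) * t) = cos t * cos (INR n * t) - sin t * sin (INR n * t).
Proof.
rewrite S_INR; replace ((INR n + 1) * t) with (t + INR n * t) by ring.
apply cos_plus.
Qed.

Lemma sin_INR_S (n : nat) (t : R) :
  sin (INR (S n) * t) = sin t * cos (INR n * t) + cos t * sin (INR n * t).
Proof.
rewrite S_INR; replace ((INR n + 1) * t) with (t + INR n * t) by ring.
apply sin_plus.
Qed.

(** With [rotate_sin_sum], the geometric identity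
    e^(it) S_n = S_n + e^(int) - 1, separated into real and imaginary parts. *)
Lemma rotate_cos_sum (n : nat) (t : R) :
  cos t * cos_sum n t - sin t * sin_sum n t = cos_sum n t + cos (INR n * t) - 1.
Proof.
induction n as [|n IH].
- simpl; rewrite Rmult_0_l, cos_0; ring.
- rewrite cos_INR_S; cbn [cos_sum sin_sum]; lra.
Qed.

Lemma rotate_sin_sum (n : nat) (t : R) :
  sin t * cos_sum n t + cos t * sin_sum n t = sin_sum n t + sin (INR n * t).
Proof.
induction n as [|n IH].
- simpl; rewrite Rmult_0_l, sin_0; ring.
- rewrite sin_INR_S; cbn [cos_sum sin_sum]; lra.
Qed.

Lemma cos2_sin2 (t : R) : cos t ^ 2 + sin t ^ 2 = 1.
Proof. generalize (sin2_cos2 t); unfold Rsqr; lra. Qed.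

(** The left side is the real part of conj(S_n) e^(int). The induction uses
    S_(n+1) = 1 + e^(it) S_n, which turns the next such real part into
    cos((n+1)t) plus the previous one; the factor cos^2 t + sin^2 t that appears
    is |e^(it)|^2. *)
Lemma dirichlet_sum (n : nat) (t : R) :
  cos_sum n t * cos (INR n * t) + sin_sum n t * sin (INR n * t) =
  sum_n_m (fun k => cos (INR k * t)) 1 n.
Proof.
induction n as [|n IH].
- rewrite sum_n_m_zero by lia; simpl; change (@zero R_AbelianMonoid) with 0; ring.
- rewrite sum_n_Sm by lia; rewrite <- IH.
  change (@plus R_AbelianMonoid) with Rplus.
  assert (HA : cos_sum (S n) t = 1 + (cos t * cos_sum n t - sin t * sin_sum n t))
    by (cbn [cos_sum]; rewrite rotate_cos_sum; ring).
  assert (HB : sin_sum (S n) t = sin t * cos_sum n t + cos t * sin_sum n t)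
    by (cbn [sin_sum]; rewrite rotate_sin_sum; ring).
  rewrite HA, HB, cos_INR_S, sin_INR_S.
  generalize (cos2_sin2 t); intros E.
  set (c := cos t) in *; set (s := sin t) in *.
  set (A := cos_sum n t); set (B := sin_sum n t).
  set (u := cos (INR n * t)); set (v := sin (INR n * t)).
  replace (A * u + B * v) with ((c ^ 2 + s ^ 2) * (A * u + B * v))
    by (rewrite E; ring).
  ring.
Qed.

(** Passing from n to n+1 adds 1 + 2 Re(conj(S_n) e^(int)) to |S_n|^2, and it
    raises every coefficient n - k by one; both increments agree by
    [dirichlet_sum]. *)
Lemma fejer_S (n : nat) (t : R) :
  fejer (S n) t =
  INR (S n) + 2 * sum_n_m (fun k => INR (S n - k) * cos (INR k * t)) 1 n.
Proof.
induction n as [|n IH].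
- rewrite sum_n_m_zero by lia; change (@zero R_AbelianMonoid) with 0.
  unfold fejer; simpl; rewrite Rmult_0_l, cos_0, sin_0; ring.
- assert (E : sum_n_m (fun k => INR (S (S n) - k) * cos (INR k * t)) 1 (S n) =
     sum_n_m (fun k => INR (S n - k) * cos (INR k * t)) 1 n
     + sum_n_m (fun k => cos (INR k * t)) 1 (S n)).
  { rewrite (sum_n_Sm _ 1 n) by lia.
    rewrite (sum_n_Sm (fun k => cos (INR k * t)) 1 n) by lia.
    change (@plus R_AbelianMonoid) with Rplus.
    rewrite <- Rplus_assoc; f_equal.
    - rewrite (sum_n_m_ext_loc _ (fun k => plus (INR (S n - k) * cos (INR k * t))
          (cos (INR k * t)))).
      + rewrite sum_n_m_plus; reflexivity.
      + intros k Hk; change (@plus R_AbelianMonoid) with Rplus.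
        replace (S (S n) - k)%nat with (S (S n - k)) by lia; rewrite S_INR.
        match goal with |- ?a = ?b => change (@eq R a b) end; ring.
    - replace (S (S n) - S n)%nat with 1%nat by lia; simpl; ring. }
  rewrite E, <- dirichlet_sum.
  replace (INR (S (S n))) with (INR (S n) + 1) by (rewrite <- S_INR; reflexivity).
  unfold fejer in *.
  change (cos_sum (S (S n)) t) with (cos_sum (S n) t + cos (INR (S n) * t)).
  change (sin_sum (S (S n)) t) with (sin_sum (S n) t + sin (INR (S n) * t)).
  generalize (cos2_sin2 (INR (S n) * t)); intros E2.
  lra.
Qed.

Lemma fejer_nonneg (n : nat) (t : R) : 0 <= fejer n t.
Proof. unfold fejer; nra. Qed.

(** The triangle inequality |S_(n+1)| <= |S_n| + 1 in squared form; the cross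
    term is controlled by Cauchy-Schwarz. *)
Lemma fejer_le (n : nat) (t : R) : fejer n t <= INR n ^ 2.
Proof.
unfold fejer; induction n as [|n IH].
- simpl; lra.
- rewrite S_INR; cbn [cos_sum sin_sum].
  generalize (cos2_sin2 (INR n * t)) (pos_INR n).
  set (A := cos_sum n t) in *; set (B := sin_sum n t) in *.
  set (u := cos (INR n * t)); set (v := sin (INR n * t)).
  intros E Hn.
  assert (H : A * u + B * v <= INR n).
  { apply Rsqr_incr_0_var; [|exact Hn]; unfold Rsqr.
    assert ((A ^ 2 + B ^ 2) * (u ^ 2 + v ^ 2)
       = (A * u + B * v) * (A * u + B * v) + (A * v - B * u) ^ 2) by ring.
    rewrite E in H. generalize (pow2_ge_0 (A * v - B * u)); lra. }
  lra.
Qed.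

(** By the geometric identity (e^(it) - 1) S_n = e^(int) - 1. *)
Lemma fejer_zero (n : nat) (t : R) :
  cos (INR n * t) = 1 -> cos t <> 1 -> fejer n t = 0.
Proof.
intros Hn Ht.
assert (Hs : sin (INR n * t) = 0) by (generalize (cos2_sin2 (INR n * t)); nra).
generalize (rotate_cos_sum n t) (rotate_sin_sum n t) (cos2_sin2 t).
rewrite Hn, Hs; unfold fejer.
set (A := cos_sum n t); set (B := sin_sum n t).
set (c := cos t) in *; set (s := sin t).
intros E1 E2 E.
assert (HA : A * (1 - c) = 0) by nra.
assert (HB : B * (1 - c) = 0) by nra.
apply Rmult_integral in HA, HB.
assert (A = 0) by lra; assert (B = 0) by lra; nra.
Qed.

(** * Lipschitz bounds for the kernel *)

Lemma cos_lipschitz (a b : R) : Rabs (cos a - cos b) <= Rabs (a - b).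
Proof.
destruct (MVT_gen cos b a (fun x => - sin x)) as [c [_ Hc]].
- intros x _; auto_derive; [easy | ring].
- intros x _; apply continuity_cos.
- rewrite Hc, Rabs_mult, Rabs_Ropp.
  assert (Rabs (sin c) <= 1) by (apply Rabs_le, SIN_bound).
  generalize (Rabs_pos (a - b)); nra.
Qed.

Lemma sin_lipschitz (a b : R) : Rabs (sin a - sin b) <= Rabs (a - b).
Proof.
rewrite <- !cos_shift.
replace (a - b) with (- ((PI / 2 - a) - (PI / 2 - b))) by ring.
rewrite Rabs_Ropp; apply cos_lipschitz.
Qed.

(** The j-th term of the exponential sum is j-Lipschitz, and
    n^2 + n <= (n+1)^2 is a convenient bound on the sum of these constants. *)
Lemma lipschitz_sum_step (n : nat) (d x y : R) :
  Rabs x <= INR n ^ 2 * d -> Rabs y <= INR n * d -> 0 <= d ->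
  Rabs (x + y) <= INR (S n) ^ 2 * d.
Proof.
intros Hx Hy Hd; rewrite S_INR.
generalize (Rabs_triang x y) (pos_INR n); nra.
Qed.

Lemma cos_sum_lipschitz (n : nat) (t u : R) :
  Rabs (cos_sum n t - cos_sum n u) <= INR n ^ 2 * Rabs (t - u).
Proof.
induction n as [|n IH].
- simpl; rewrite Rminus_diag, Rabs_R0; lra.
- cbn [cos_sum].
  replace (_ + _ - _) with ((cos_sum n t - cos_sum n u)
    + (cos (INR n * t) - cos (INR n * u))) by ring.
  apply lipschitz_sum_step; [exact IH | | apply Rabs_pos].
  eapply Rle_trans; [apply cos_lipschitz|].
  rewrite <- Rmult_minus_distr_l, Rabs_mult, (Rabs_pos_eq _ (pos_INR n)); lra.
Qed.

Lemma sin_sum_lipschitz (n : nat) (t u : R) :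
  Rabs (sin_sum n t - sin_sum n u) <= INR n ^ 2 * Rabs (t - u).
Proof.
induction n as [|n IH].
- simpl; rewrite Rminus_diag, Rabs_R0; lra.
- cbn [sin_sum].
  replace (_ + _ - _) with ((sin_sum n t - sin_sum n u)
    + (sin (INR n * t) - sin (INR n * u))) by ring.
  apply lipschitz_sum_step; [exact IH | | apply Rabs_pos].
  eapply Rle_trans; [apply sin_lipschitz|].
  rewrite <- Rmult_minus_distr_l, Rabs_mult, (Rabs_pos_eq _ (pos_INR n)); lra.
Qed.

(** A zero of the kernel is a zero of both sums, so each of them is at most
    its Lipschitz bound: this makes the kernel quadratically small there
    without any second derivative. *)
Lemma fejer_le_sq_dist (n : nat) (t u : R) :
  fejer n u = 0 -> fejer n t <= 2 * (INR n ^ 2 * Rabs (t - u)) ^ 2.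
Proof.
unfold fejer; intros Hu.
assert (HA : cos_sum n u = 0) by nra.
assert (HB : sin_sum n u = 0) by nra.
generalize (cos_sum_lipschitz n t u) (sin_sum_lipschitz n t u).
rewrite HA, HB, !Rminus_0_r; intros H1 H2.
rewrite <- (pow2_abs (cos_sum n t)), <- (pow2_abs (sin_sum n t)).
generalize (Rabs_pos (cos_sum n t)) (Rabs_pos (sin_sum n t)); nra.
Qed.

Lemma fejer_lipschitz (n : nat) (t u : R) :
  Rabs (fejer n t - fejer n u) <= 4 * INR n * (INR n ^ 2 * Rabs (t - u)).
Proof.
assert (bnd : forall s, Rabs (cos_sum n s) <= INR n /\ Rabs (sin_sum n s) <= INR n).
{ intros s; generalize (fejer_le n s) (pos_INR n); unfold fejer; intros H Hn.
  split; apply Rabs_le; split; nra. }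
destruct (bnd t) as [At Bt], (bnd u) as [Au Bu].
unfold fejer.
replace (_ - _) with
  ((cos_sum n t + cos_sum n u) * (cos_sum n t - cos_sum n u)
   + (sin_sum n t + sin_sum n u) * (sin_sum n t - sin_sum n u)) by ring.
assert (prod : forall x y d L, Rabs x <= INR n -> Rabs y <= INR n -> Rabs d <= L ->
  Rabs ((x + y) * d) <= 2 * INR n * L).
{ intros x y d L Hx Hy Hd; rewrite Rabs_mult.
  apply Rmult_le_compat; try apply Rabs_pos; [|exact Hd].
  generalize (Rabs_triang x y); lra. }
generalize (prod _ _ _ _ At Au (cos_sum_lipschitz n t u))
  (prod _ _ _ _ Bt Bu (sin_sum_lipschitz n t u)).
intros H1 H2; eapply Rle_trans; [apply Rabs_triang|]; lra.
Qed.

(** * The coefficients F(x,i) / i^2 on the real line *)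

Definition ratio (x : R) (i : nat) : R :=
  fejer i (2 * PI * x / INR i) / (INR i * INR i).

Lemma ratio_nonneg (x : R) (i : nat) : (1 <= i)%nat -> 0 <= ratio x i.
Proof.
intros Hi; apply le_INR in Hi; simpl in Hi.
unfold ratio; apply Rdiv_le_0_compat; [apply fejer_nonneg | nra].
Qed.

Lemma ratio_le_1 (x : R) (i : nat) : (1 <= i)%nat -> ratio x i <= 1.
Proof.
intros Hi; apply le_INR in Hi; simpl in Hi.
unfold ratio; apply Rle_div_l; [nra|].
generalize (fejer_le i (2 * PI * x / INR i)); lra.
Qed.

(** The angle 2 pi x / i varies slowly when i is large; this is what absorbs
    one factor i of the Lipschitz constants and makes the next bounds uniform
    in i. *)
Lemma angle_dist (x y : R) (i : nat) : (1 <= i)%nat ->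
  INR i * Rabs (2 * PI * x / INR i - 2 * PI * y / INR i) = 2 * PI * Rabs (x - y).
Proof.
intros Hi; apply le_INR in Hi; simpl in Hi.
rewrite <- (Rabs_pos_eq (INR i)) at 1 by lra.
rewrite <- Rabs_mult.
replace (INR i * _) with (2 * PI * (x - y)) by (field; lra).
rewrite Rabs_mult, (Rabs_pos_eq (2 * PI)); [reflexivity|].
generalize PI_RGT_0; lra.
Qed.

Lemma ratio_lipschitz (x y : R) (i : nat) : (1 <= i)%nat ->
  Rabs (ratio x i - ratio y i) <= 8 * PI * Rabs (x - y).
Proof.
intros Hi; generalize (angle_dist x y i Hi); intros E.
apply le_INR in Hi; simpl in Hi.
unfold ratio, Rdiv at 1 3; rewrite <- Rmult_minus_distr_r.
fold (Rdiv (fejer i (2 * PI * x / INR i) - fejer i (2 * PI * y / INR i)) (INR i * INR i)).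
rewrite Rabs_div by nra.
rewrite (Rabs_pos_eq (INR i * INR i)) by nra.
apply Rle_div_l; [nra|].
eapply Rle_trans; [apply fejer_lipschitz|].
replace (8 * PI * Rabs (x - y)) with (4 * (2 * PI * Rabs (x - y))) by ring.
rewrite <- E; apply Req_le; ring.
Qed.

Lemma ratio_le_sq_dist (x y : R) (i : nat) : (1 <= i)%nat -> ratio y i = 0 ->
  ratio x i <= 8 * PI ^ 2 * (x - y) ^ 2.
Proof.
intros Hi Hy; generalize (angle_dist x y i Hi); intros E.
apply le_INR in Hi; simpl in Hi.
assert (Hf : fejer i (2 * PI * y / INR i) = 0).
{ unfold ratio, Rdiv at 1 in Hy; apply Rmult_integral in Hy.
  destruct Hy as [Hy|Hy]; [exact Hy|].
  apply Rinv_neq_0_compat in Hy; [easy | nra]. }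
unfold ratio; apply Rle_div_l; [nra|].
eapply Rle_trans; [apply (fejer_le_sq_dist _ _ _ Hf)|].
rewrite <- (pow2_abs (x - y)).
replace (8 * PI ^ 2 * Rabs (x - y) ^ 2) with (2 * (2 * PI * Rabs (x - y)) ^ 2)
  by ring.
rewrite <- E; apply Req_le; ring.
Qed.

Lemma cos_eq_1 (a : R) : cos a = 1 -> exists k : Z, a = 2 * PI * IZR k.
Proof.
intros Ha.
assert (H : sin (a / 2) = 0).
{ replace a with (2 * (a / 2)) in Ha by field.
  rewrite cos_2a_sin in Ha; nra. }
apply sin_eq_0_0 in H; destruct H as [k Hk]; exists k; lra.
Qed.

(** The angle t = 2 pi m / i satisfies i t = 2 pi m, and e^(it) = 1 only if
    m / i is an integer, so the sum over all powers of e^(it) vanishes. *)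
Lemma ratio_nondivisor (m i : nat) : (1 <= i)%nat ->
  ~ (Z.of_nat i | Z.of_nat m)%Z -> ratio (INR m) i = 0.
Proof.
intros Hi Hnd; apply le_INR in Hi; simpl in Hi.
unfold ratio; rewrite fejer_zero; [unfold Rdiv; ring | | ].
- replace (INR i * _) with (0 + 2 * INR m * PI) by (field; lra).
  rewrite cos_period; apply cos_0.
- intros H; apply cos_eq_1 in H; destruct H as [k Hk]; apply Hnd; exists k.
  apply eq_IZR; rewrite mult_IZR, <- !INR_IZR_INZ.
  generalize PI_RGT_0; intros HPI.
  apply (f_equal (fun z => z * (INR i / (2 * PI)))) in Hk.
  field_simplify in Hk; lra.
Qed.

Lemma ratio_even_2 (k : nat) : ratio (2 * INR k) 2 = 1.
Proof.
unfold ratio, fejer; cbn [cos_sum sin_sum]; simpl (INR 2); simpl (INR 1); simpl (INR 0).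
rewrite Rmult_0_l, cos_0, sin_0.
replace (1 * _) with (0 + 2 * INR k * PI) by field.
rewrite cos_period, sin_period, cos_0, sin_0; field.
Qed.

(** * The series and its continuity *)

Definition term (q x : R) (n : nat) : R := ratio x (n + 2) * / q ^ (n + 2).

(** The positive factor (q-1) q is left out: it affects neither the zeros
    nor the signs. *)
Definition real_frakF (q x : R) : R := Series (term q x) - exp (- (x * ln q)).

Lemma Series_zero : Series (fun _ => 0) = 0.
Proof.
transitivity (0 * Series (fun _ => 0)); [|ring].
rewrite <- Series_scal_l; apply Series_ext; intros n; ring.
Qed.

Lemma Series_nonneg (a : nat -> R) :
  (forall n, 0 <= a n) -> ex_series a -> 0 <= Series a.
Proof.
intros Ha Hex; rewrite <- Series_zero; apply Series_le; [|exact Hex].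
intros n; split; [apply Rle_refl | apply Ha].
Qed.

Lemma inv_pow_pos (q : R) (n : nat) : 1 < q -> 0 < / q ^ n.
Proof. intros; apply Rinv_0_lt_compat, pow_lt; lra. Qed.

Lemma ex_series_inv_pow (q : R) : 1 < q -> ex_series (fun n => / q ^ (n + 2)).
Proof.
intros hq.
apply ex_series_ext with (fun n => scal (/ q ^ 2) ((/ q) ^ n)).
- intros n; rewrite pow_add, pow_inv; 
  rewrite Rinv_mult; unfold scal; simpl; unfold mult; simpl; ring.
- apply (@ex_series_scal R_AbsRing R_NormedModule (/ q ^ 2)), ex_series_geom.
  rewrite Rabs_pos_eq; [|left; apply Rinv_0_lt_compat; lra].
  rewrite <- Rinv_1; apply Rinv_lt_contravar; lra.
Qed.

Lemma term_nonneg (q x : R) (n : nat) : 1 < q -> 0 <= term q x n.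
Proof.
intros hq; apply Rmult_le_pos; [apply ratio_nonneg; lia|].
left; now apply inv_pow_pos.
Qed.

Lemma term_le (q x : R) (n : nat) : 1 < q -> term q x n <= / q ^ (n + 2).
Proof.
intros hq; generalize (inv_pow_pos q (n + 2) hq) (ratio_le_1 x (n + 2) ltac:(lia)).
unfold term; nra.
Qed.

Lemma ex_series_term (q x : R) : 1 < q -> ex_series (term q x).
Proof.
intros hq; apply (ex_series_le (term q x) (fun n => / q ^ (n + 2)));
  [|now apply ex_series_inv_pow].
intros n; change (norm (term q x n)) with (Rabs (term q x n)).
rewrite Rabs_pos_eq; [now apply term_le | now apply term_nonneg].
Qed.

Lemma series_term_lipschitz (q x y : R) : 1 < q ->
  Rabs (Series (term q x) - Series (term q y)) <=
  8 * PI * Series (fun n => / q ^ (n + 2)) * Rabs (x - y).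
Proof.
intros hq.
rewrite <- Series_minus by now apply ex_series_term.
replace (8 * PI * _ * _) with
  ((8 * PI * Rabs (x - y)) * Series (fun n => / q ^ (n + 2))) by ring.
rewrite <- Series_scal_l.
assert (H : forall n, Rabs (term q x n - term q y n) <=
  8 * PI * Rabs (x - y) * / q ^ (n + 2)).
{ intros n; unfold term; rewrite <- Rmult_minus_distr_r, Rabs_mult.
  generalize (inv_pow_pos q (n + 2) hq); intros Hq.
  rewrite (Rabs_pos_eq (/ _)) by lra.
  apply Rmult_le_compat_r; [lra|]; apply ratio_lipschitz; lia. }
assert (Hex : ex_series (fun n => 8 * PI * Rabs (x - y) * / q ^ (n + 2)))
  by now apply (@ex_series_scal R_AbsRing R_NormedModule (8 * PI * Rabs (x - y))), ex_series_inv_pow.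
eapply Rle_trans; [apply Series_Rabs|apply Series_le]; trivial.
- apply (ex_series_le (fun n => Rabs (term q x n - term q y n)) _) with (2 := Hex).
  intros n; change (norm ?a) with (Rabs a); rewrite Rabs_Rabsolu; apply H.
- intros n; split; [apply Rabs_pos | apply H].
Qed.

Lemma continuity_lipschitz (f : R -> R) (L : R) :
  (forall x y, Rabs (f x - f y) <= L * Rabs (x - y)) -> continuity f.
Proof.
intros Hf x eps Heps.
assert (HL : 0 < Rabs L + 1) by (generalize (Rabs_pos L); lra).
exists (eps / (Rabs L + 1)); split; [now apply Rdiv_lt_0_compat|].
intros y [_ Hy]; simpl in *; unfold Rdist in *.
apply Rlt_div_r in Hy; [|exact HL].
generalize (Hf y x) (Rle_abs L) (Rabs_pos (y - x)); nra.
Qed.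

Lemma continuity_real_frakF (q : R) : 1 < q -> continuity (real_frakF q).
Proof.
intros hq; apply continuity_minus.
- apply continuity_lipschitz with (1 := fun x y => series_term_lipschitz q x y hq).
- intros x; apply continuity_pt_filterlim, (ex_derive_continuous (fun z => exp (- (z * ln q)))).
  auto_derive; trivial.
Qed.

Lemma inv_pow_exp (q : R) (m : nat) : 0 < q -> / q ^ m = exp (- (INR m * ln q)).
Proof.
intros hq; rewrite exp_Ropp, <- Rpower_pow by exact hq; reflexivity.
Qed.

(** * The change of sign *)

Lemma real_frakF_even_pos (q : R) (k : nat) : 1 < q -> (2 <= k)%nat ->
  0 < real_frakF q (2 * INR k).
Proof.
intros hq Hk.
assert (H0 : term q (2 * INR k) 0 <= Series (term q (2 * INR k))).
{ rewrite Series_incr_1 by now apply ex_series_term.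
  assert (0 <= Series (fun n => term q (2 * INR k) (S n))); [|lra].
  apply Series_nonneg.
  - intros n; now apply term_nonneg.
  - apply (ex_series_incr_1 (term q (2 * INR k))); now apply ex_series_term. }
unfold term at 1 in H0; rewrite Nat.add_0_l, ratio_even_2, inv_pow_exp in H0 by lra.
unfold real_frakF.
assert (exp (- (2 * INR k * ln q)) < exp (- (INR 2 * ln q))); [|lra].
apply exp_increasing.
assert (0 < ln q) by (rewrite <- ln_1; apply ln_increasing; lra).
apply le_INR in Hk; simpl in *; nra.
Qed.

Lemma is_series_single (m : nat) (c : R) :
  is_series (fun n => if Nat.eq_dec n m then c else 0) c.
Proof.
apply filterlim_ext_loc with (fun _ => c); [|apply filterlim_const].
assert (lt : forall N, (N < m)%nat ->
  sum_n (fun n => if Nat.eq_dec n m then c else 0) N = 0).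
{ induction N as [|N IH]; intros HN.
  - rewrite sum_O; destruct Nat.eq_dec; [lia | reflexivity].
  - rewrite sum_Sn, IH by lia; destruct Nat.eq_dec; [lia | apply Rplus_0_r]. }
exists m; intros N HN; symmetry.
induction HN as [|N HN IH].
- destruct m as [|m].
  + rewrite sum_O; destruct Nat.eq_dec; [reflexivity | lia].
  + rewrite sum_Sn, lt by lia; destruct Nat.eq_dec; [apply Rplus_0_l | lia].
- rewrite sum_Sn, IH; destruct Nat.eq_dec; [lia | apply Rplus_0_r].
Qed.

(** The index i = m contributes at most q^(-m); no other i >= 2 divides the
    prime m, so the remaining coefficients vanish at m and are quadratically small
    nearby. *)
Lemma series_term_near_prime (q x : R) (m : nat) : 1 < q ->
  prime (Z.of_nat m) ->
  Series (term q x) <=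
  / q ^ m + 8 * PI ^ 2 * (x - INR m) ^ 2 * Series (fun n => / q ^ (n + 2)).
Proof.
intros hq Hm.
assert (H2 : (2 <= m)%nat) by (destruct Hm as [Hm _]; lia).
set (c := 8 * PI ^ 2 * (x - INR m) ^ 2).
assert (Hc : 0 <= c) by (unfold c; generalize (pow2_ge_0 PI) (pow2_ge_0 (x - INR m)); nra).
set (d := fun n => if Nat.eq_dec n (m - 2) then / q ^ m else 0).
generalize (is_series_single (m - 2) (/ q ^ m)); fold d; intros Hd.
assert (He : ex_series (fun n => c * / q ^ (n + 2)))
  by now apply (@ex_series_scal R_AbsRing R_NormedModule c), ex_series_inv_pow.
rewrite <- (is_series_unique _ _ Hd), <- Series_scal_l, <- Series_plus
  by (trivial; now exists (/ q ^ m)).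
apply Series_le.
- intros n; split; [now apply term_nonneg|].
  generalize (inv_pow_pos q (n + 2) hq); intros Hq.
  unfold d; destruct Nat.eq_dec as [->|Hn].
  + replace (m - 2 + 2)%nat with m in Hq by lia.
    generalize (term_le q x (m - 2) hq).
    replace (m - 2 + 2)%nat with m by lia; nra.
  + rewrite Rplus_0_l; unfold term, c.
    apply Rmult_le_compat_r; [lra|].
    apply ratio_le_sq_dist; [lia|].
    apply ratio_nondivisor; [lia|].
    intros Hdiv; apply (prime_divisors _ Hm) in Hdiv; lia.
- apply (ex_series_plus d); [now exists (/ q ^ m) | exact He].
Qed.

(** The loss M h^2 must be beaten by the linear gain c h with
    c = q^(-m) log q. *)
Lemma real_frakF_neg_left_of_prime (q : R) (m : nat) : 1 < q ->
  prime (Z.of_nat m) ->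
  exists h, 0 < h < 1 /\ real_frakF q (INR m - h) < 0.
Proof.
intros hq Hm.
assert (Hln : 0 < ln q) by (rewrite <- ln_1; apply ln_increasing; lra).
generalize (inv_pow_pos q m hq); intros Hqm.
set (K := Series (fun n => / q ^ (n + 2))).
assert (HK : 0 <= K).
{ apply Series_nonneg.
  - intros n; generalize (inv_pow_pos q (n + 2) hq); lra.
  - now apply ex_series_inv_pow. }
set (M := 8 * PI ^ 2 * K).
assert (HM : 0 <= M) by (unfold M; generalize (pow2_ge_0 PI); nra).
set (c := / q ^ m * ln q).
assert (Hc : 0 < c) by (unfold c; nra).
(* Any h < c / M would do; this choice is moreover below 1 and is defined
   when M = 0. *)
set (h := c / (M + c + 1)).
assert (Hh : h * (M + c + 1) = c) by (unfold h; field; lra).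
assert (Hh0 : 0 < h) by (unfold h; apply Rdiv_lt_0_compat; lra).
exists h; split; [split; nra|].
unfold real_frakF.
generalize (series_term_near_prime q (INR m - h) m hq Hm); fold K.
replace (INR m - h - INR m) with (- h) by ring.
replace (8 * PI ^ 2 * (- h) ^ 2 * K) with (M * h * h) by (unfold M; ring).
intros HS.
replace (- ((INR m - h) * ln q)) with (- (INR m * ln q) + h * ln q) by ring.
rewrite exp_plus, <- inv_pow_exp by lra.
assert (He : 1 + h * ln q < exp (h * ln q)) by (apply exp_ineq1; nra).
assert (/ q ^ m * (1 + h * ln q) < / q ^ m * exp (h * ln q)) by nra.
replace (/ q ^ m * (1 + h * ln q)) with (/ q ^ m + c * h) in H by (unfold c; ring).
nra.
Qed.

(** * Restriction of the complex function to the real line *)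

Lemma Ccos_RtoC (x : R) : Ccos (RtoC x) = RtoC (cos x).
Proof.
unfold Ccos, Cexp; apply injective_projections; simpl;
  rewrite !Rmult_0_l, ?Rmult_0_r, ?Rmult_1_l, ?Rplus_0_l, ?Rminus_0_r, ?Ropp_0, ?exp_0;
  rewrite ?cos_neg, ?sin_neg; field.
Qed.

Lemma sum_n_m_RtoC (f : nat -> R) (n : nat) :
  sum_n_m (fun k => RtoC (f k)) 1 n = RtoC (sum_n_m f 1 n).
Proof.
induction n as [|n IH].
- rewrite !sum_n_m_zero by lia; reflexivity.
- rewrite !sum_n_Sm, IH by lia; symmetry; apply RtoC_plus.
Qed.

Lemma FF_RtoC (x : R) (i : nat) : (1 <= i)%nat ->
  FF (RtoC x) i = RtoC (fejer i (2 * PI * x / INR i)).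
Proof.
intros Hi; destruct i as [|n]; [lia|]; unfold FF.
assert (Hn : INR (S n) <> 0) by (apply not_0_INR; lia).
rewrite (sum_n_m_ext _ (fun k => RtoC (INR (S n - k)
   * cos (INR k * (2 * PI * x / INR (S n)))))).
- rewrite sum_n_m_RtoC, fejer_S, Nat.sub_1_r, Nat.pred_succ, RtoC_plus, RtoC_mult.
  reflexivity.
- intros k; rewrite RtoC_mult, <- Ccos_RtoC; do 2 f_equal.
  rewrite !RtoC_mult, !RtoC_div, !RtoC_mult by exact Hn. 
  field; intros E; apply Hn, RtoC_inj, E.
Qed.

Lemma CSeries_RtoC (a : nat -> R) : CSeries (fun n => RtoC (a n)) = RtoC (Series a).
Proof. unfold CSeries; simpl; now rewrite Series_zero. Qed.

Lemma CSeries_ext (a b : nat -> C) : (forall n, a n = b n) -> CSeries a = CSeries b.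
Proof.
intros H; unfold CSeries; f_equal; apply Series_ext; intros n; now rewrite H.
Qed.

Lemma frakF_RtoC (q x : R) : 1 < q ->
  frakF (RtoC x) q = RtoC ((q - 1) * q * real_frakF q x).
Proof.
intros hq; unfold frakF, real_frakF.
rewrite (CSeries_ext _ (fun n => RtoC (term q x n))).
- rewrite CSeries_RtoC.
  replace (Cexp (- (x * ln q))) with (RtoC (exp (- (x * ln q)))).
  + rewrite !RtoC_mult, !RtoC_minus; reflexivity.
  + unfold Cexp; apply injective_projections; simpl.
    * rewrite !Rmult_0_r, Rmult_0_l, Rplus_0_l, Ropp_0, cos_0, Rminus_0_r; ring.
    * rewrite !Rmult_0_r, Rmult_0_l, Rplus_0_l, Ropp_0, sin_0; ring.
- intros n; cbv zeta; rewrite FF_RtoC by lia; unfold term, ratio.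
  assert (Hn : INR (n + 2) <> 0) by (apply not_0_INR; lia).
  assert (Hq : q ^ (n + 2) <> 0) by (apply pow_nonzero; lra).
  rewrite RtoC_mult, RtoC_div, RtoC_inv, RtoC_mult, RtoC_pow; trivial; nra.
Qed.

Theorem theorem4p4 (q : R) (p : Z) (hq : (1 < q)%R)
    (hp : Znumtheory.prime p) (hodd : Z.Odd p) (hp5 : (5 <= p)%Z) :
  exists x : R, (IZR p - 1 < x < IZR p)%R /\ frakF (RtoC x) q = RtoC 0.
Proof.
destruct hodd as [k Hk].
set (m := Z.to_nat p).
assert (Hm : Z.of_nat m = p) by (unfold m; lia).
assert (Em : IZR p = INR m) by (rewrite INR_IZR_INZ, Hm; reflexivity).
assert (Ek : 2 * INR (Z.to_nat k) = INR m - 1).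
{ rewrite <- Em, Hk, plus_IZR, mult_IZR, INR_IZR_INZ, Z2Nat.id by lia; ring. }
rewrite <- Hm in hp.
destruct (real_frakF_neg_left_of_prime q m hq hp) as [h [Hh Hneg]].
generalize (real_frakF_even_pos q (Z.to_nat k) hq ltac:(lia)).
rewrite Ek; intros Hpos.
destruct (IVT (fun x => - real_frakF q x) (INR m - 1) (INR m - h)) as [x [Hx Hx0]].
- now apply continuity_opp, continuity_real_frakF.
- lra.
- lra.
- lra.
- assert (H0 : real_frakF q x = 0) by lra.
  assert (x <> INR m - 1) by (intros ->; lra).
  exists x; rewrite Em; split; [lra|].
  rewrite frakF_RtoC, H0, Rmult_0_r by exact hq; reflexivity.
Qed.
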